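(* For $b(\cdot,\cdot)$ the discrete inf-sup property holds for the pair of spaces $(\mathbf U_h,M_h)=\big((V_h^k)^3,V_h^l\big)$ with $1\le l\le k$: there is a constant $d>0$, which can be taken independent of $h$ and of how $\Gamma$ intersects the outer triangulation (but depends on $k$), such that $$\sup_{\mathbf v_h\in(V_h^k)^3}\frac{b(\mathbf v_h,\mu_h)}{\|\mathbf v_h\|_U}\ge d\,\|\mu_h\|_M\quad\text{for all }\mu_h\in V_h^l.$$
   Context: $\Gamma\subset\mathbb R^3$ is a closed, sufficiently smooth surface with outward unit normal $\mathbf n$, and $\mathbf P=\mathbf I-\mathbf n\mathbf n^T$. For vector functions $\nabla\mathbf u:=(\nabla u_1\ \nabla u_2\ \nabla u_3)^T$ (Jacobian). $\Omega\subset\mathbb R^3$ is a fixed polygonal domain strictly containing $\Gamma$, with a shape regular family of tetrahedral triangulations $\{\mathcal T_h\}_{h>0}$ (the outer triangulations). $\mathcal T_h^\Gamma$ is the set of tetrahedra of $\mathcal T_h$ with nonzero intersection with $\Gamma$ (the family $\{\mathcal T_h^\Gamma\}$ is assumed quasi-uniform), and $\Omega_h^\Gamma:=\mathrm{int}(\overline{\cup_{T\in\mathcal T_h^\Gamma}T})$. It is assumed that $\Omega_h^\Gamma$ is contained in a neighborhood $\mathcal O(\Gamma)$ of $\Gamma$ in which the signed distance function to $\Gamma$ is smooth; $\mathbf n$ is extended as the gradient of this function. $V_h^m$ is the space of continuous functions on $\Omega_h^\Gamma$ that are piecewise polynomial of degree $m$ on $\mathcal T_h^\Gamma$. $E_s(\mathbf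 u):=\tfrac12\mathbf P(\nabla\mathbf u+\nabla\mathbf u^T)\mathbf P$, $\mathbf H:=\nabla\mathbf n$ on $\Gamma$; $\mathbf u=\mathbf u_T+u_N\mathbf n$ with $\mathbf u_T\cdot\mathbf n=0$. On $\Gamma$, $$a(\mathbf u,\mathbf v):=\int_\Gamma\mathrm{tr}\big((E_s(\mathbf u_T)+u_N\mathbf H)(E_s(\mathbf v_T)+v_N\mathbf H)\big)+\mathbf u\cdot\mathbf v\,ds.$$ With the stabilization parameter $\rho>0$: $$A_h(\mathbf u,\mathbf v):=a(\mathbf u,\mathbf v)+\rho\int_{\Omega_h^\Gamma}(\nabla\mathbf u\,\mathbf n)\cdot(\nabla\mathbf v\,\mathbf n)\,dx,$$ $$b(\mathbf u,\mu):=(\mathbf u\cdot\mathbf n,\mu)_{L^2(\Gamma)}+\rho\int_{\Omega_h^\Gamma}(\mathbf n^T\nabla\mathbf u\,\mathbf n)(\mathbf n\cdot\nabla\mu)\,dx,$$ $\|\mathbf u\|_U^2:=A_h(\mathbf u,\mathbf u)$ and $\|\mu\|_M^2:=\|\mu\|_{L^2(\Gamma)}^2+\rho\|\mathbf n\cdot\nabla\mu\|_{L^2(\Omega_h^\Gamma)}^2$. Standing assumption on $\rho$: $\rho=c_\alpha h^{1-\alpha}$ with $\alpha\in[0,2]$, $h\le h_0\le1$ and $0<c_\alpha<d_2^{-2}h_0^{\alpha-2}$, where $d_1,d_2>0$ are constants independent of $h$ and of how $\Gamma$ intersects the outer triangulation such that $\sup_{\mathbf v_h\in(V_h^k)^3}b(\mathbf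 v_h,\mu_h)/\|\mathbf v_h\|_U\ge d_1(1-d_2\sqrt{\rho h})\|\mu_h\|_M$ for all $\mu_h\in V_h^k$. *)

(* Defs.v *)
From HB Require Import structures.
From mathcomp Require Import all_boot all_order all_algebra.
From mathcomp Require Import all_classical all_reals all_analysis.
From mathcomp Require mpoly.

Set Implicit Arguments.
Unset Strict Implicit.
Unset Printing Implicit Defensive.

Import Order.TTheory GRing.Theory Num.Theory.
Import numFieldNormedType.Exports.

Local Open Scope classical_set_scope.
Local Open Scope ring_scope.

(* Points and vectors of R^3 are columns. The library norm on matrices is the
   maximum norm; it is only used for the topology and for derivatives. Lengths
   and distances are measured with the Euclidean norm [enorm]. *)
Notation R3 R := 'cV[R]_3.

Section Euclidean.
Context {R : realType}.
Implicit Types (x y u v : R3 R) (A : set (R3 R)).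

Definition dot u v : R := \sum_i u i 0 * v i 0.

Definition enorm u : R := Num.sqrt (dot u u).

(* diam set0 = 0 *)
Definition diam A : \bar R :=
  ereal_sup (0%E |` [set (enorm (z.1 - z.2))%:E | z in A `*` A]).

Definition dist_to A x : R := inf [set enorm (x - y) | y in A].

Definition basis (i : 'I_3) : R3 R := delta_mx i 0.

End Euclidean.

Section SurfaceMeasure.
Context {R : realType}.
Local Open Scope ereal_scope.

Definition gauge2 (delta : R) (A : set (R3 R)) : \bar R :=
  if diam A <= delta%:E then (pi / 4)%:E * (diam A * diam A) else +oo.

(* [mu_ext] over the sigma-algebra of all subsets: the infimum ranges over all
   countable covers, and pieces of diameter larger than delta cost +oo. *)
Definition hausdorff2_pre (delta : R) : set (R3 R) -> \bar R :=
  @mu_ext _ (g_sigma_algebraType [set: set (R3 R)]) R (gauge2 delta).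

(* Two-dimensional Hausdorff measure, normalised by the area pi/4 of the disc of
   diameter 1: the surface area on C^1 surfaces. *)
Definition hausdorff2 (A : set (R3 R)) : \bar R :=
  ereal_sup [set hausdorff2_pre delta A | delta in [set delta : R | (0 < delta)%R]].

Lemma diam_ge0 (A : set (R3 R)) : 0 <= diam A.
Proof. by apply: ereal_sup_ubound; left. Qed.

Lemma diam0 : diam (set0 : set (R3 R)) = 0.
Proof.
apply/eqP; rewrite eq_le diam_ge0 andbT; apply: ge_ereal_sup => e [->//|].
by move=> [[y z] [[]]].
Qed.

Lemma gauge2_ge0 delta (A : set (R3 R)) : 0 <= gauge2 delta A.
Proof.
rewrite /gauge2; case: ifP => // _.
rewrite mule_ge0 ?mule_ge0 ?diam_ge0// lee_fin.
by rewrite divr_ge0// pi_ge0.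
Qed.

Lemma gauge20 delta : (0 < delta)%R -> gauge2 delta set0 = 0.
Proof. by move=> d0; rewrite /gauge2 diam0 lee_fin (ltW d0) !mule0. Qed.

Lemma hausdorff2_ge0 A : 0 <= hausdorff2 A.
Proof.
apply: (@le_trans _ _ (hausdorff2_pre 1 A)).
  by apply: mu_ext_ge0 => *; exact: gauge2_ge0.
by apply: ereal_sup_ubound; exists 1%R => /=.
Qed.

Lemma hausdorff20 : hausdorff2 set0 = 0.
Proof.
apply/eqP; rewrite eq_le hausdorff2_ge0 andbT.
apply: ge_ereal_sup => _ [d /= d0 <-]; rewrite /hausdorff2_pre.
rewrite (_ : mu_ext _ _ = 0)//.
by apply: mu_ext0 => [|X]; [exact: gauge20|exact: gauge2_ge0].
Qed.

Lemma le_hausdorff2 : {homo hausdorff2 : A B / A `<=` B >-> A <= B}.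
Proof.
move=> A B AB; apply: ge_ereal_sup => _ [d /= d0 <-].
apply: (@le_trans _ _ (hausdorff2_pre d B)); first exact: le_mu_ext.
by apply: ereal_sup_ubound; exists d.
Qed.

Lemma hausdorff2_sigma_subadditive : sigma_subadditive hausdorff2.
Proof.
move=> F; apply: ge_ereal_sup => _ [d /= d0 <-].
apply: (@le_trans _ _ (\sum_(i <oo) hausdorff2_pre d (F i))).
  by apply: (@mu_ext_sigma_subadditive _
    (g_sigma_algebraType [set: set (R3 R)])) => X; exact: gauge2_ge0.
apply: lee_nneseries => i _ *.
  by apply: mu_ext_ge0 => *; exact: gauge2_ge0.
by apply: ereal_sup_ubound; exists d.
Qed.

HB.instance Definition _ := isOuterMeasure.Build R (R3 R) hausdorff2
  hausdorff20 hausdorff2_ge0 le_hausdorff2 hausdorff2_sigma_subadditive.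

Definition hausdorff2_outer : {outer_measure set (R3 R) -> \bar R} := hausdorff2.

End SurfaceMeasure.

Section Integrals.
Context {R : realType}.

Definition surface_integral (Gam : set (R3 R)) (f : R3 R -> R) : R :=
  @Rintegral _ (caratheodory_type (@hausdorff2_outer R)) R hausdorff2_outer Gam f.

Definition point3 (p : R * R * R) : R3 R :=
  \col_i [:: p.1.1; p.1.2; p.2]`_i.

Definition volume_integral (D : set (R3 R)) (f : R3 R -> R) : R :=
  Rintegral
    ((lebesgue_measure \x lebesgue_measure) \x lebesgue_measure)%E
    (point3 @^-1` D) (f \o point3).

End Integrals.

Section Calculus.
Context {R : realType}.

Definition grad (f : R3 R -> R) (x : R3 R) : R3 R :=
  \col_i 'D_(basis i) f x.

Definition jac (u : R3 R -> R3 R) (x : R3 R) : 'M[R]_3 :=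
  \matrix_(i, j) 'D_(basis j) (fun y => u y i 0) x.

(* f is of class C^k on the open set U *)
Fixpoint class_C (k : nat) (U : set (R3 R)) (f : R3 R -> R) : Prop :=
  if k is k'.+1 then
    (forall x, U x -> differentiable f x) /\
    (forall i, class_C k' U (fun x => 'D_(basis i) f x))
  else forall x, U x -> {for x, continuous f}.

End Calculus.

Section Surface.
Context {R : realType}.

(* Gam is the compact boundary of the bounded open set G and is locally the
   regular zero level of a C^r function which is negative exactly in G: a closed
   embedded C^r surface, whose outward side is the one pointing out of G. *)
Definition closed_surface (r : nat) (G Gam : set (R3 R)) : Prop :=
  [/\ open G, G !=set0, bounded_set G, Gam = closure G `\` G &
    forall x, Gam x -> exists U phi,
      [/\ open U, U x, class_C r U phi, grad phi x != 0 &
          forall y, U y -> (G y <-> phi y < 0) /\ (Gam y <-> phi y = 0)]].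

Variables (G Gam : set (R3 R)).

Definition signed_dist (x : R3 R) : R :=
  if x \in G then - dist_to Gam x else dist_to Gam x.

Definition normal (x : R3 R) : R3 R := grad signed_dist x.

Definition proj (x : R3 R) : 'M[R]_3 := 1%:M - normal x *m (normal x)^T.

(* The product (jac u) P, with the derivatives along the tangent vectors P e_j
   taken directly. Where u is differentiable this is the matrix product, by
   [jac_projE]. A finite element function restricted to Gam has these derivatives
   almost everywhere on Gam even when a flat piece of Gam lies in a face of the
   mesh, where the full Jacobian does not exist. *)
Definition jac_proj (u : R3 R -> R3 R) (x : R3 R) : 'M[R]_3 :=
  \matrix_(i, j) 'D_(proj x *m basis j) (fun y => u y i 0) x.

(* (1/2) P (jac u + (jac u)^T) P, see [EsE] *)
Definition Es (u : R3 R -> R3 R) (x : R3 R) : 'M[R]_3 :=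
  2^-1 *: (proj x *m jac_proj u x + (jac_proj u x)^T *m proj x).

Lemma proj_tr x : (proj x)^T = proj x.
Proof. by rewrite /proj linearB/= trmx1 trmx_mul trmxK. Qed.

Lemma jac_projE (u : R3 R -> R3 R) x : (forall i, differentiable (fun y => u y i 0 : R) x) ->
  jac_proj u x = jac u x *m proj x.
Proof.
move=> du; apply/matrixP => i j; rewrite !mxE deriveE//.
move: (proj x) => P.
have -> : P *m basis j = \sum_l P l j *: basis l.
  rewrite [LHS](_ : _ = col j P); last by rewrite colE.
  apply/matrixP => a b; rewrite !mxE summxE (bigD1 a)//= big1 ?addr0.
    by rewrite !mxE eqxx ord1 eqxx mulr1.
  by move=> l la; rewrite !mxE eq_sym (negbTE la) mulr0.
rewrite linear_sum/=; apply: eq_bigr => l _.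
by rewrite linearZ/= [jac u x i l]mxE deriveE// mulrC.
Qed.

Lemma EsE (u : R3 R -> R3 R) x : (forall i, differentiable (fun y => u y i 0 : R) x) ->
  Es u x = 2^-1 *: (proj x *m (jac u x + (jac u x)^T) *m proj x).
Proof.
move=> du; rewrite /Es jac_projE// trmx_mul proj_tr.
by move: (proj x) => P; rewrite mulmxDr mulmxDl !mulmxA.
Qed.

Definition weingarten (x : R3 R) : 'M[R]_3 := jac normal x.

Definition tangential (u : R3 R -> R3 R) (x : R3 R) : R3 R := proj x *m u x.

Definition normal_comp (u : R3 R -> R3 R) (x : R3 R) : R :=
  dot (u x) (normal x).

Definition form_a (u v : R3 R -> R3 R) : R :=
  surface_integral Gam (fun x =>
    \tr ((Es (tangential u) x + normal_comp u x *: weingarten x) *m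
         (Es (tangential v) x + normal_comp v x *: weingarten x))
    + dot (u x) (v x)).

(* rho is the stabilization parameter, D stands for Omega_h^Gamma *)
Variables (rho : R) (D : set (R3 R)).

Definition form_A (u v : R3 R -> R3 R) : R :=
  form_a u v + rho * volume_integral D (fun x =>
    dot (jac u x *m normal x) (jac v x *m normal x)).

Definition form_b (u : R3 R -> R3 R) (mu : R3 R -> R) : R :=
  surface_integral Gam (fun x => dot (u x) (normal x) * mu x)
  + rho * volume_integral D (fun x =>
      dot (normal x) (jac u x *m normal x) * dot (normal x) (grad mu x)).

Definition norm_U (u : R3 R -> R3 R) : R := Num.sqrt (form_A u u).

Definition norm_M (mu : R3 R -> R) : R :=
  Num.sqrt (surface_integral Gam (fun x => mu x ^+ 2)
    + rho * volume_integral D (fun x => dot (normal x) (grad mu x) ^+ 2)).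

(* sup of b(v, mu) / ||v||_U over the v in W with ||v||_U <> 0 *)
Definition sup_b (W : set (R3 R -> R3 R)) (mu : R3 R -> R) : \bar R :=
  ereal_sup [set (form_b v mu / norm_U v)%:E | v in
    [set v | W v /\ 0 < norm_U v]].

End Surface.

Section Mesh.
Context {R : realType}.

Definition tetra := 'I_4 -> R3 R.

Definition face (T : tetra) (I : {set 'I_4}) : set (R3 R) :=
  [set x | exists c : 'I_4 -> R,
    [/\ forall i, 0 <= c i, forall i, i \notin I -> c i = 0,
        \sum_i c i = 1 & x = \sum_i c i *: T i]].

Definition tet (T : tetra) : set (R3 R) := face T [set: 'I_4]%SET.

Definition nondegenerate (T : tetra) : Prop :=
  forall c : 'I_4 -> R,
    \sum_i c i = 0 -> \sum_i c i *: T i = 0 -> forall i, c i = 0.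

Definition triangulation (Omega : set (R3 R)) (Th : set tetra) : Prop :=
  [/\ finite_set Th,
      forall T, Th T -> nondegenerate T,
      closure Omega = \bigcup_(T in Th) tet T &
      forall S T, Th S -> Th T -> exists I J,
        tet S `&` tet T = face S I /\ tet S `&` tet T = face T J].

Definition polyhedral_domain (Omega : set (R3 R)) : Prop :=
  [/\ open Omega, connected Omega, Omega !=set0,
      Omega = interior (closure Omega) &
      exists Th, triangulation Omega Th].

Definition inradius (T : tetra) : R :=
  sup [set r | 0 <= r /\ exists c, [set x | enorm (x - c) <= r] `<=` tet T].

(* A family of meshes assigns to h the set of all meshes of size h under
   consideration, so that meshes lying differently with respect to Gam may share
   the same h; a family with one mesh for each h is a special case. *)
Definition mesh_family := R -> set (set tetra).

Definition shape_regular (F : mesh_family) : Prop :=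
  exists kappa : R, forall h Th T, 0 < h -> F h Th -> Th T ->
    (diam (tet T) <= (kappa * inradius T)%:E)%E.

Variable Gam : set (R3 R).

Definition cut_mesh (Th : set tetra) : set tetra :=
  [set T | Th T /\ tet T `&` Gam !=set0].

Definition cut_domain (Th : set tetra) : set (R3 R) :=
  interior (closure (\bigcup_(T in cut_mesh Th) tet T)).

Definition quasi_uniform (F : mesh_family) : Prop :=
  exists2 q : R, 0 < q & forall h Th T, 0 < h -> F h Th -> cut_mesh Th T ->
    ((q * h)%:E <= diam (tet T) /\ diam (tet T) <= h%:E)%E.

(* The values of f outside cut_domain are irrelevant. *)
Definition fe_space (Th : set tetra) (m : nat) : set (R3 R -> R) :=
  [set f | (forall x, cut_domain Th x -> {for x, continuous f}) /\
    forall T, cut_mesh Th T -> exists p : mpoly.mpoly 3 R,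
      (forall e, mpoly.mcoeff e p != 0 -> (mpoly.mdeg e <= m)%N) /\
      forall x, (tet T `&` cut_domain Th) x ->
        f x = mpoly.meval (fun i => x i 0) p].

Definition fe_space3 (Th : set tetra) (m : nat) : set (R3 R -> R3 R) :=
  [set u | forall i, fe_space Th m (fun x => u x i 0)].

End Mesh.

(* Main.v *)
Require Import Defs.
From HB Require Import structures.
From mathcomp Require Import all_boot all_order all_algebra.
From mathcomp Require Import all_classical all_reals all_analysis.
From mathcomp Require Import ring.

Set Implicit Arguments.
Unset Strict Implicit.
Unset Printing Implicit Defensive.

Import Order.TTheory GRing.Theory Num.Theory.
Import numFieldNormedType.Exports.

Local Open Scope classical_set_scope.
Local Open Scope ring_scope.

(** The hypothesis on b already provides the inf-sup bound on the multiplier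
    space of degree k, with the constant d1 (1 - d2 sqrt(rho h)), and the
    multiplier spaces of lower degree are contained in that one
    ([fe_space_le]). So only a positive lower bound of this constant, uniform in
    h, is missing. Since rho h = c_alpha h^(2 - alpha) with alpha <= 2, the
    quantity rho h does not decrease with h, and the constant is smallest at
    h = h0 ([stabilization_le]). The upper bound on c_alpha says exactly that it
    is still positive there ([sqrt_stabilization_lt]). As the value at h0 involves
    neither h nor the mesh, it can serve as d. *)

Section InfSupConstant.
Context {R : realType}.

Lemma fe_space_le (Gam : set (R3 R)) (Th : set (@tetra R)) l k :
  (l <= k)%N -> fe_space Gam Th l `<=` fe_space Gam Th k.
Proof.
move=> lk mu [cmu pmu]; split=> // T /pmu[p [degp mup]].
by exists p; split=> // e /degp /leq_trans; apply.
Qed.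

(** The exponent 2 - alpha is nonnegative: this is where alpha <= 2 enters. *)
Lemma stabilization_le (c alpha h h0 : R) :
  0 <= c -> alpha <= 2 -> 0 < h <= h0 ->
  c * h `^ (1 - alpha) * h <= c * h0 `^ (2 - alpha).
Proof.
move=> c0 alpha2 /andP[h_gt0 hh0].
rewrite -mulrA ler_wpM2l// -{2}(powRr1 (ltW h_gt0)) -powRD; last first.
  by rewrite (gt_eqF h_gt0) implybT.
have -> : 1 - alpha + 1 = 2 - alpha by ring.
by rewrite ge0_ler_powR ?subr_ge0 ?nnegrE ?(ltW h_gt0) ?(le_trans (ltW h_gt0)).
Qed.

Lemma sqrt_stabilization_lt (c alpha h0 d2 : R) :
  0 < h0 -> 0 < d2 -> c < d2 ^- 2 * h0 `^ (alpha - 2) ->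
  d2 * Num.sqrt (c * h0 `^ (2 - alpha)) < 1.
Proof.
move=> h0_gt0 d2_gt0 c_lt.
rewrite mulrC -ltr_pdivlMr// div1r -[ltRHS]ger0_norm ?invr_ge0 ?ltW//.
rewrite -sqrtr_sqr ltr_sqrt ?exprn_gt0 ?invr_gt0// exprVn.
rewrite -ltr_pdivlMr ?powR_gt0// -powRN.
by have -> : - (2 - alpha) = alpha - 2 by ring.
Qed.

End InfSupConstant.

Theorem corollary4p5 (R : realType) (r k : nat)
    (G Gam Nbh Omega : set (R3 R)) (F : @mesh_family R)
    (alpha h0 c_alpha d1 d2 : R) :
  (2 <= r)%N ->
  closed_surface r G Gam ->
  open Nbh -> Gam `<=` Nbh -> class_C r Nbh (signed_dist G Gam) ->
  polyhedral_domain Omega -> Gam `<=` Omega ->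
  (forall h Th, 0 < h -> F h Th -> triangulation Omega Th) ->
  shape_regular F ->
  quasi_uniform Gam F ->
  (forall h Th, 0 < h -> F h Th -> cut_domain Gam Th `<=` Nbh) ->
  0 <= alpha <= 2 ->
  0 < h0 <= 1 ->
  0 < d1 -> 0 < d2 ->
  0 < c_alpha < d2 ^- 2 * h0 `^ (alpha - 2) ->
  let rho h := c_alpha * h `^ (1 - alpha) in
  (forall h Th, 0 < h <= h0 -> F h Th ->
    forall mu, fe_space Gam Th k mu ->
      ((d1 * (1 - d2 * Num.sqrt (rho h * h))
          * norm_M G Gam (rho h) (cut_domain Gam Th) mu)%:E
        <= sup_b G Gam (rho h) (cut_domain Gam Th) (fe_space3 Gam Th k) mu)%E) ->
  exists2 d : R, 0 < d &
    forall l, (1 <= l <= k)%N ->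
    forall h Th, 0 < h <= h0 -> F h Th ->
    forall mu, fe_space Gam Th l mu ->
      ((d * norm_M G Gam (rho h) (cut_domain Gam Th) mu)%:E
        <= sup_b G Gam (rho h) (cut_domain Gam Th) (fe_space3 Gam Th k) mu)%E.
Proof.
move=> _ _ _ _ _ _ _ _ _ _ _ /andP[_ alpha2] /andP[h0_gt0 _] d1_gt0 d2_gt0.
move=> /andP[c_gt0 c_lt] rho infsup.
exists (d1 * (1 - d2 * Num.sqrt (c_alpha * h0 `^ (2 - alpha)))).
  by rewrite mulr_gt0// subr_gt0 sqrt_stabilization_lt.
move=> l /andP[_ lk] h Th hh0 Fh mu /(fe_space_le lk) mu_k.
apply: le_trans (infsup h Th hh0 Fh mu mu_k).
rewrite lee_fin ler_wpM2r ?sqrtr_ge0// ler_wpM2l ?(ltW d1_gt0)//.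
rewrite lerD2l lerN2 ler_wpM2l ?(ltW d2_gt0)// ler_wsqrtr//.
exact: stabilization_le (ltW c_gt0) alpha2 hh0.
Qed.
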